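(* The continuum $\mathbb{H}^*=\beta\mathbb{H}\setminus\mathbb{H}$, where $\mathbb{H}=[0,\infty)$, is not chainable, and for every non-principal ultrafilter $u$ on $\omega$ the continuum $\mathbb{I}_u$ is not chainable.
   Context: A continuum is a (nonempty) compact connected Hausdorff space. $\beta X$ is the Čech-Stone compactification of $X$. A continuum is chainable if every open cover of it has an open refinement (covering the continuum) that is a chain cover, i.e. a finite cover $\{C_1,\dots,C_m\}$ such that $C_i\cap C_j\neq\emptyset$ if and only if $|i-j|\le 1$. The continuum $\mathbb{I}_u$: let $\mathbb{M}=\omega\times[0,1]$, $\pi:\mathbb{M}\to\omega$, $\pi(n,x)=n$, with Čech-Stone extension $\beta\pi:\beta\mathbb{M}\to\beta\omega$. For $u\in\omega^*=\beta\omega\setminus\omega$ put $\mathbb{I}_u=(\beta\pi)^{-1}(u)$, which is a continuum. *)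

(* Defs.v *)
From HB Require Import structures.
From mathcomp Require Import all_boot all_order all_algebra.
From mathcomp Require Import all_classical all_reals all_analysis.
Set Implicit Arguments.
Unset Strict Implicit.
Unset Printing Implicit Defensive.
Import Order.TTheory GRing.Theory Num.Theory.
Import numFieldNormedType.Exports.
Local Open Scope classical_set_scope.
Local Open Scope ring_scope.

(* A subset A of a space is viewed as a space through [set_type A], which
   carries the subspace topology. *)

Definition continuum (X : topologicalType) : Prop :=
  [/\ [set: X] !=set0, compact [set: X], connected [set: X]
    & hausdorff_space X].

Definition chain_cover (X : topologicalType) (m : nat) (C : 'I_m -> set X) :
    Prop :=
  cover [set: 'I_m] C = [set: X] /\
  forall i j : 'I_m,
    C i `&` C j !=set0 <-> `|(i : nat)%:Z - (j : nat)%:Z| <= 1.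

(* Only the covering condition: that X is a continuum is stated separately,
   so that [~ chainable X] never holds merely because X is not one. *)
Definition chainable (X : topologicalType) : Prop :=
  forall U : set (set X),
    (forall V, U V -> open V) -> cover U id = [set: X] ->
    exists (m : nat) (C : 'I_m -> set X),
      [/\ chain_cover C, forall i, open (C i)
        & forall i, exists2 V, U V & C i `<=` V].

Section Subset.
Variables (X : topologicalType) (A : set X).

Lemma set_val_continuous : continuous (\val : set_type A -> X).
Proof. exact: (@initial_continuous _ X \val). Qed.

Lemma set_type_hausdorff : hausdorff_space X -> hausdorff_space (set_type A).
Proof.
rewrite !open_hausdorff => hX x y xy.
have /hX[[V W]] /= : \val x != \val y by apply: contra_neq xy; exact: val_inj.
move=> [xV yW] [Vo Wo /eqP VW0].
exists (\val @^-1` V, \val @^-1` W); first by rewrite !inE/= in xV yW *.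
split; [by exists V|by exists W|].
by rewrite -preimage_setI VW0 preimage_set0.
Qed.

Lemma set_type_compact : compact A -> compact [set: set_type A].
Proof.
move=> cA F FF _.
have FA : ((\val : set_type A -> X) @ F) A.
  by apply: (@filterS _ F _ setT) filterT => -[x Ax] _; exact: set_mem.
have [p [Ap pF]] := cA _ (fmap_proper_filter (\val : set_type A -> X) FF) FA.
exists (SigSub (mem_set Ap)); split => // B C FB [_ [[V Vo <-] /= Vp VC]].
have FB' : ((\val : set_type A -> X) @ F) [set \val x | x in B].
  by apply: (@filterS _ F _ B) FB => x Bx; exists x.
have [_ [[x Bx <-] Vx]] := pF _ _ FB' (open_nbhs_nbhs (conj Vo Vp)).
by exists x; split => //; exact: VC.
Qed.

End Subset.

Section StoneCech.
Variable R : realType.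

Definition unit_itv : topologicalType := set_type (`[0, 1]%classic : set R).

Section Compactification.
Variable X : topologicalType.

(* The cube [0,1]^C(X,[0,1]) with the product topology. *)
Definition sc_cube : topologicalType :=
  prod_topology (fun _ : continuousType X unit_itv => unit_itv).

Lemma continuous_sc_cube (Z : topologicalType) (h : Z -> sc_cube) :
  (forall g, continuous (fun z => h z g)) -> continuous h.
Proof.
move=> hg z; apply/cvg_sup => g.
exact: (@continuous_comp_initial sc_cube Z unit_itv (fun p => p g) h (hg g)).
Qed.

Lemma sc_proj_continuous (g : continuousType X unit_itv) :
  continuous (fun p : sc_cube => p g).
Proof. exact: (@proj_continuous _ (fun=> unit_itv) g). Qed.

Definition sc_eval (x : X) : sc_cube := fun f => f x.

(* Tychonoff's construction (for X a Tychonoff space, X then embeds through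
   [sc_unit] below): the closure of the image of X under the
   evaluation map into the cube. *)
Definition stone_cech : topologicalType :=
  set_type (closure (range sc_eval)).

Lemma sc_eval_closure (x : X) : sc_eval x \in closure (range sc_eval).
Proof. by apply/mem_set/subset_closure; exists x. Qed.

Definition sc_unit (x : X) : stone_cech := SigSub (sc_eval_closure x).

Definition remainder : set stone_cech := ~` range sc_unit.

Lemma sc_unit_continuous : continuous sc_unit.
Proof.
apply: (@continuous_comp_initial stone_cech X sc_cube \val sc_unit).
apply: continuous_sc_cube => g; exact: (@cts_fun _ _ g).
Qed.

Lemma sc_unit_dense : closure (range sc_unit) = [set: stone_cech].
Proof.
apply/seteqP; split=> // p _ B [_ [[V Vo <-] /= Vp VB]].
have /set_mem/(_ V (open_nbhs_nbhs (conj Vo Vp))) := valP p.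
by move=> [_ [[x _ <-]] Vx]; exists (sc_unit x); split; [exists x|exact: VB].
Qed.

Lemma stone_cech_hausdorff : hausdorff_space stone_cech.
Proof.
apply: set_type_hausdorff; apply: (@hausdorff_product _ (fun=> unit_itv)) => _.
exact/set_type_hausdorff/Rhausdorff.
Qed.

Lemma stone_cech_compact : compact [set: stone_cech].
Proof.
apply: set_type_compact; apply: (subclosed_compact (@closed_closure _ _)).
  apply: (@tychonoff (continuousType X unit_itv) (fun=> unit_itv) (fun=> setT)).
  by move=> _; exact/set_type_compact/segment_compact.
by [].
Qed.

End Compactification.

Section Extension.
Variables X Y : topologicalType.
Variable f : continuousType X Y.

Definition cube_map (p : sc_cube X) : sc_cube Y :=
  fun g : continuousType Y unit_itv => p (g \o f : continuousType X unit_itv).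

Lemma cube_map_continuous : continuous cube_map.
Proof. by apply: continuous_sc_cube => g; exact: sc_proj_continuous. Qed.

Lemma cube_map_closure (p : stone_cech X) :
  cube_map (\val p) \in closure (range (@sc_eval Y)).
Proof.
apply/mem_set => B /cube_map_continuous.
have /set_mem := valP p => /[apply] -[_ [[x _ <-]] Bx].
by exists (sc_eval (f x)); split => //; exists (f x).
Qed.

(* The Cech-Stone extension of f. *)
Definition sc_map (p : stone_cech X) : stone_cech Y :=
  SigSub (cube_map_closure p).

Lemma sc_map_unit (x : X) : sc_map (sc_unit x) = sc_unit (f x).
Proof. exact: val_inj. Qed.

Lemma sc_map_continuous : continuous sc_map.
Proof.
apply: (@continuous_comp_initial (stone_cech Y) (stone_cech X) (sc_cube Y) \val).
move=> p; apply: (@continuous_comp (stone_cech X) (sc_cube X) (sc_cube Y)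
  \val cube_map p); [exact: set_val_continuous|exact: cube_map_continuous].
Qed.

End Extension.

(* The points of the remainder of omega (discrete) are the limits of the
   non-principal ultrafilters on omega. *)
Lemma remainder_natP (u : stone_cech nat) :
  remainder u <->
  exists F : set_system nat,
    [/\ UltraFilter F, forall n, ~ F [set n] & @sc_unit nat @ F --> u].
Proof.
split=> [un|[F [FU Fn Fu]] [n _ nu]].
- pose G : set_system nat := filter_from (nbhs u) (fun V => @sc_unit nat @^-1` V).
  have GF : ProperFilter G.
    apply: filter_from_proper.
      apply: filter_from_filter; first by exists setT; exact: filterT.
      by move=> V W Vu Wu; exists (V `&` W) => //; exact: filterI.
    move=> V Vu; have : closure (range (@sc_unit nat)) u by rewrite sc_unit_dense.
    by move=> /(_ V Vu)[_ [[n _ <-] Vn]]; exists n.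
  have [F [FU GF']] := ultraFilterLemma GF.
  have Fu : @sc_unit nat @ F --> u.
    by move=> V Vu; apply: GF'; exists V.
  exists F; split => // n Fn; apply: un; exists n => //.
  apply/esym/(@stone_cech_hausdorff nat) => V W Vu Wn.
  exists (sc_unit n); split; last exact: nbhs_singleton.
  have FV : F (@sc_unit nat @^-1` V) := Fu V Vu.
  by have [m [/= -> Vn]] := filter_ex (filterI Fn FV).
- have h0 : (0 : R) \in (`[0, 1]%classic : set R) by rewrite inE/= in_itv/= lexx ler01.
  have h1 : (1 : R) \in (`[0, 1]%classic : set R) by rewrite inE/= in_itv/= lexx ler01.
  pose g (m : nat) : unit_itv := if m == n then SigSub h1 else SigSub h0.
  have gc : continuous g.
    by move=> m V /nbhs_singleton Vm; apply/principal_filterP.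
  pose ev (p : stone_cech nat) : R :=
    set_val ((set_val p : sc_cube nat) (mkcts gc)).
  have ev_continuous : continuous ev.
    move=> p; apply: (@continuous_comp (stone_cech nat) unit_itv R
      (fun p => (set_val p : sc_cube nat) (mkcts gc)) set_val p);
      last exact: set_val_continuous.
    apply: (@continuous_comp (stone_cech nat) (sc_cube nat) unit_itv
      set_val (fun q => q (mkcts gc)) p); first exact: set_val_continuous.
    exact: sc_proj_continuous.
  have evE m : ev (sc_unit m) = set_val (g m) by [].
  pose V := ev @^-1` [set x : R | 0 < x].
  have Vu : nbhs u V.
    apply: ev_continuous; apply: open_nbhs_nbhs; split; first exact: open_gt.
    by rewrite -nu /= evE /g eqxx /= ltr01.
  have FV : F (@sc_unit nat @^-1` V) := Fu V Vu.
  apply: (Fn n); apply: filterS FV => m.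
  by rewrite /V /= evE /g; case: eqP => //= _; rewrite ltxx.
Qed.

Definition MM : topologicalType := (nat * unit_itv)%type.

Lemma fst_continuous : continuous (fst : MM -> nat).
Proof. by move=> x; exact: cvg_fst. Qed.

Definition MM_proj : continuousType MM nat := mkcts fst_continuous.

(* For u in the remainder of omega, the continuum I_u. *)
Definition II (u : stone_cech nat) : set (stone_cech MM) :=
  sc_map MM_proj @^-1` [set u].

Definition HH : topologicalType := set_type (`[0, +oo[%classic : set R).

Definition HH_star : set (stone_cech HH) := @remainder HH.

End StoneCech.

Arguments remainder R X : clear implicits.
Arguments HH_star R : clear implicits.

(* Main.v *)
(* Both continua are fibres [phi @^-1` [set y]] of a continuous map phi defined
   on some beta X: for H* take phi to be the extension of x |-> 1 / (1 + x) and
   y = 0, for I_u the extension of the projection of MM onto omega and y = u.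
   By compactness the sets phi^-1(V), V a neighbourhood of y, form a
   neighbourhood base of the fibre, so the fibre inherits properties of the
   connected pieces of X (tails of H, intervals {n} x [0,1]) lying in them.

   Non-chainability: let t(x) = x on H and t(n, x) = n * x on MM, and extend
   (cos t, sin t) to a map of beta X to the unit circle. If the fibre were
   chainable, refining the cover of the fibre by the preimages of the four open
   half circles to a finite chain would give a continuous argument G of this map
   on the fibre, bounded because the fibre is compact. Extend G to beta X by
   Tietze; near the fibre cos (t - G) > -1. But on connected pieces of X near
   the fibre t varies by arbitrarily large amounts while G is bounded, so t - G
   takes an odd multiple of pi as value, a contradiction. *)

Require Import Defs.
From mathcomp Require Import all_boot all_order all_algebra.
From mathcomp Require Import all_classical all_reals all_analysis.
From mathcomp Require Import ring lra zify.
Set Implicit Arguments.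
Unset Strict Implicit.
Unset Printing Implicit Defensive.
Import Order.TTheory GRing.Theory Num.Theory.
Import numFieldNormedType.Exports.
Local Open Scope classical_set_scope.
Local Open Scope ring_scope.

(** * Branches of the argument on the unit circle *)

Inductive quadrant := East | North | West | South.

Section Angles.
Variable R : realType.
Implicit Types (c s : R) (q : quadrant).

Definition half_plane q c s : Prop :=
  match q with East => 0 < c | North => 0 < s | West => c < 0 | South => s < 0 end.

Definition angle q c s : R :=
  match q with
  | East => asin s | North => acos c | West => pi - asin s | South => - acos c
  end.

(* Two branches agree on their common domain except in the third quadrant:
   [angle West] takes values in ]pi/2, 3pi/2[ and [angle South] in ]-pi, 0[. *)
Definition jump q q' : R :=
  match q, q' with
  | West, South => pi *+ 2 | South, West => - (pi *+ 2) | _, _ => 0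
  end.

Lemma circle_bounds c s : c ^+ 2 + s ^+ 2 = 1 -> (-1 <= c <= 1) * (-1 <= s <= 1).
Proof. by move=> e; split; nra. Qed.

(** Since [c] is nonnegative, [acos c] lies in [[0, pi / 2]], where [asin] inverts [sin], and
    [s = sin (acos c)]. *)
Lemma asin_acos c s : c ^+ 2 + s ^+ 2 = 1 -> 0 <= c -> 0 <= s -> asin s = acos c.
Proof.
move=> e c0 s0; have [cb sb] := circle_bounds e.
have -> : s = sin (acos c).
  by rewrite sin_acos// -e addrAC subrr add0r sqrtr_sqr ger0_norm.
rewrite sinK// in_itv/=.
have p0 := pi_gt0 R; have a0 := acos_ge0 cb.
have -> /= : - (pi / 2) <= acos c by lra.
(* If [acos c] exceeded [pi / 2], strict decrease of [cos] on [[0, pi]] would make [c] negative. *)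
rewrite leNgt; apply/negP => h.
have := @ltr_cos R (pi / 2) (acos c); rewrite !in_itv/= acos_ge0// acos_lepi//.
have -> : 0 <= pi / 2 :> R by lra.
rewrite cos_pihalf acosK ?in_itv//= h.
have -> : pi / 2 <= pi :> R by lra.
by move=> /(_ isT isT); rewrite ltNge c0.
Qed.

Lemma asin_opp s : -1 <= s <= 1 -> asin (- s) = - asin s.
Proof.
move=> sb; rewrite -{1}(@asinK R s) ?in_itv// -sinN sinK// in_itv/=.
by rewrite lerN2 asin_lepi2//= lerNl asin_geNpi2.
Qed.

(** Opposite half planes are disjoint, and neighbouring ones meet in an open quadrant; there the
    comparison is [asin_acos] for the point reflected into the first quadrant. *)
Lemma angle_jump q q' c s : c ^+ 2 + s ^+ 2 = 1 ->
  half_plane q c s -> half_plane q' c s -> angle q c s = angle q' c s + jump q q'.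
Proof.
move=> e; have [cb sb] := circle_bounds e.
have eN : (- c) ^+ 2 + s ^+ 2 = 1 by rewrite sqrrN.
have eS : c ^+ 2 + (- s) ^+ 2 = 1 by rewrite sqrrN.
have eNS : (- c) ^+ 2 + (- s) ^+ 2 = 1 by rewrite !sqrrN.
have h1 := asin_acos e; have h2 := asin_acos eN.
have h3 := asin_acos eS; have h4 := asin_acos eNS.
rewrite ?acosN ?asin_opp// in h2 h3 h4.
by case: q; case: q' => //= hq hq';
  try (by exfalso; lra);
  rewrite ?mulr2n ?addr0//;
  first [have := h1 _ _ | have := h2 _ _ | have := h3 _ _ | have := h4 _ _]; lra.
Qed.

Lemma cos_angle q c s : c ^+ 2 + s ^+ 2 = 1 -> half_plane q c s ->
  cos (angle q c s) = c.
Proof.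
move=> e; have [cb sb] := circle_bounds e.
have ec : 1 - s ^+ 2 = c ^+ 2 by rewrite -e addrK.
case: q => /= h; rewrite ?cosN ?acosK ?in_itv//.
- by rewrite cos_asin// ec sqrtr_sqr gtr0_norm.
- by rewrite addrC cosDpi cosN cos_asin// ec sqrtr_sqr ltr0_norm// opprK.
Qed.

Lemma sin_angle q c s : c ^+ 2 + s ^+ 2 = 1 -> half_plane q c s ->
  sin (angle q c s) = s.
Proof.
move=> e; have [cb sb] := circle_bounds e.
have es : 1 - c ^+ 2 = s ^+ 2 by rewrite -e addrAC subrr add0r.
case: q => /= h; rewrite ?asinK ?in_itv//.
- by rewrite sin_acos// es sqrtr_sqr gtr0_norm.
- by rewrite addrC sinDpi sinN asinK ?in_itv// opprK.
- by rewrite sinN sin_acos// es sqrtr_sqr ltr0_norm// opprK.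
Qed.

Lemma half_plane_cover c s : c ^+ 2 + s ^+ 2 = 1 -> exists q, half_plane q c s.
Proof.
move=> e; case: (ltrgtP c 0) => c0; [by exists West|by exists East|].
case: (ltrgtP s 0) => s0; [by exists South|by exists North|].
by move: e; rewrite c0 s0 expr0n addr0 => /esym/eqP; rewrite oner_eq0.
Qed.

(** In the open half plane the coordinate fed to [asin] or [acos] stays strictly between -1 and
    1. *)
Lemma angle_continuous (T : topologicalType) (c s : T -> R) (q : quadrant) :
  continuous c -> continuous s -> (forall p, c p ^+ 2 + s p ^+ 2 = 1) ->
  forall p, half_plane q (c p) (s p) ->
  {for p, continuous (fun p => angle q (c p) (s p))}.
Proof.
move=> cc cs e p; have ep := e p.
have ac : -1 < c p < 1 -> {for p, continuous (fun p => acos (c p))}.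
  by move=> h; apply: (continuous_comp (cc p)); exact: continuous_acos.
have as_ : -1 < s p < 1 -> {for p, continuous (fun p => asin (s p))}.
  by move=> h; apply: (continuous_comp (cs p)); exact: continuous_asin.
case: q => /= h.
- by apply: as_; nra.
- by apply: ac; nra.
- by apply: continuousB; [exact: cst_continuous|apply: as_; nra].
- by apply: continuousN; apply: ac; nra.
Qed.

Lemma half_plane_open (T : topologicalType) (c s : T -> R) (q : quadrant) :
  continuous c -> continuous s -> open [set p | half_plane q (c p) (s p)].
Proof.
move=> cc cs; case: q => /=.
- by apply: (@open_comp T R c [set x | 0 < x]) => //; exact: open_gt.
- by apply: (@open_comp T R s [set x | 0 < x]) => //; exact: open_gt.
- by apply: (@open_comp T R c [set x | x < 0]) => //; exact: open_lt.
- by apply: (@open_comp T R s [set x | x < 0]) => //; exact: open_lt.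
Qed.

End Angles.

(** * Lifting circle-valued maps from chainable spaces to the line *)

Section Lift.
Variable R : realType.

Lemma trig_jump (q q' : quadrant) (x : R) :
  cos (x + jump R q q') = cos x /\ sin (x + jump R q q') = sin x.
Proof.
have pp (y : R) : cos (y + pi *+ 2) = cos y /\ sin (y + pi *+ 2) = sin y.
  by rewrite cosD2pi sinD2pi.
case: q; case: q' => /=; rewrite ?addr0 ?cosD2pi ?sinD2pi//.
by have := pp (x - pi *+ 2); rewrite subrK => -[-> ->].
Qed.

(* Since only consecutive links meet, the branches of the argument on the
   links can be corrected one after the other. *)
Lemma chainable_circle_lift (T : topologicalType) (c s : T -> R) : chainable T ->
  continuous c -> continuous s -> (forall p, c p ^+ 2 + s p ^+ 2 = 1) ->
  exists G : T -> R,
    continuous G /\ forall p, cos (G p) = c p /\ sin (G p) = s p.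
Proof.
move=> chT cc cs e.
pose H (q : quadrant) := [set p | half_plane q (c p) (s p)].
have [||m [C [[Ccov Cch] Co CU]]] := chT (range H).
- by move=> _ [q _ <-]; exact: half_plane_open.
- apply/seteqP; split=> // p _; have [q qp] := half_plane_cover (e p).
  by exists (H q) => //; exists q.
have /choice[q qP] : forall i, exists q, C i `<=` H q.
  by move=> i; have [_ [q _ <-]] := CU i; exists q.
(* The default [East] is a filler, since links have index below [m]. *)
pose qn k := if insub k is Some i then q i else East.
have qnE (i : 'I_m) : qn i = q i by rewrite /qn valK.
(* The jumps accumulated from link 0 to link [k]; they total a multiple of 2 pi. *)
pose shift := fix shift k : R :=
  if k is k'.+1 then shift k' + jump R (qn k') (qn k) else 0.
pose loc (i : 'I_m) p := angle (q i) (c p) (s p) + shift i.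
have trig_shift k x : cos (x + shift k) = cos x /\ sin (x + shift k) = sin x.
  elim: k => [|k [<- <-]] /=; first by rewrite addr0.
  by rewrite addrA; exact: trig_jump.
have loc_next (i j : 'I_m) p : (j : nat) = i.+1 -> C i p -> C j p ->
    loc i p = loc j p.
  move=> ji /qP ip /qP jp.
  rewrite /loc ji /= -ji !qnE (angle_jump (e p) ip jp); ring.
have loc_agree (i j : 'I_m) p : C i p -> C j p -> loc i p = loc j p.
  move=> ip jp; have /Cch : C i `&` C j !=set0 by exists p.
  move=> ij; have [ij'|ji'|ij'] := ltngtP (i : nat) (j : nat).
  - by apply: loc_next => //; lia.
  - by apply/esym/loc_next => //; lia.
  - by congr loc; exact: val_inj.
have /choice[idx idxP] : forall p, exists i, C i p.
  by move=> p; have : [set: T] p by []; rewrite -Ccov => -[i _ ip]; exists i.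
pose G p := loc (idx p) p.
exists G; split => [p|p]; last first.
  have [-> ->] := trig_shift (idx p) (angle (q (idx p)) (c p) (s p)).
  by rewrite cos_angle ?sin_angle//; exact: qP.
(* Near [p] the chosen link may change, but on the open link [C (idx p)] the function [G] equals the
   branch of that one link. *)
apply: (@cvg_trans _ (loc (idx p) @ p)).
  apply: near_eq_cvg; apply: filterS (open_nbhs_nbhs (conj (Co (idx p)) (idxP p))).
  by move=> p' ip'; exact: loc_agree.
apply: cvgD; last exact: cvg_cst.
by apply: angle_continuous => //; exact: qP.
Qed.

(** Compactness of [A] bounds the lift, and Tietze's theorem extends it with the same bound. *)
Lemma chainable_circle_lift_extension (K : topologicalType) (A : set K)
    (c s : K -> R) :
  hausdorff_space K -> compact [set: K] -> closed A -> chainable (set_type A) ->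
  continuous c -> continuous s -> (forall p, A p -> c p ^+ 2 + s p ^+ 2 = 1) ->
  exists (G : K -> R) (M : R), [/\ continuous G, forall p, `|G p| <= M &
    forall p, A p -> c p = cos (G p) /\ s p = sin (G p)].
Proof.
move=> hK kK clA chA cc cs e.
have [||p|g [cg gE]] := @chainable_circle_lift (set_type A)
  (fun p => c (\val p)) (fun p => s (\val p)) chA.
- by move=> p; apply: continuous_comp; [exact: set_val_continuous|exact: cc].
- by move=> p; apply: continuous_comp; [exact: set_val_continuous|exact: cs].
- by apply: e; exact: set_mem (valP p).
have kg : compact (range g).
  apply: (@continuous_compact _ _ g [set: set_type A]).
    exact/continuous_subspaceT.
  exact/set_type_compact/(subclosed_compact clA kK).
have [M [_ gM]] := compact_bounded (kg : compact (range g : set R^o)).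
(* The bound must lie strictly above [M] here and be positive for the extension theorem. *)
have {}gM p : `|g p| <= `|M| + 1.
  apply: (gM (`|M| + 1)); last by exists p.
  by rewrite (le_lt_trans (ler_norm M))// ltrDl ltr01.
(* The value 0 off [A] is arbitrary: only continuity within [A] is used. *)
pose f (p : K) : R^o := if pselect (A p) is left Ap then g (SigSub (mem_set Ap)) else 0.
have fE : sigL A f = g.
  apply/funext => p; rewrite /sigL /= /f; case: pselect => [Ap|/(_ (set_mem (valP p)))//].
  by congr g; exact: val_inj.
have fc : {within A, continuous f} by apply/subspace_sigL_continuousP; rewrite fE.
have fM p : A p -> `|f p| <= `|M| + 1.
  by move=> Ap; rewrite /f; case: pselect => // Ap'; exact: gM.
have M0 : 0 < `|M| + 1 by rewrite ltr_wpDl.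
have [G [fG cG GM]] :=
  continuous_bounded_extension (compact_normal hK kK) clA M0 fc fM.
exists G, (`|M| + 1); split => // p Ap.
have -> : G p = g (SigSub (mem_set Ap)).
  rewrite -fG ?inE// /f; case: pselect => // Ap'.
  by congr g; exact: val_inj.
by have [-> ->] := gE (SigSub (mem_set Ap)).
Qed.

End Lift.

(** * Fibres of continuous maps on compact spaces *)

Section Fiber.
Variables (R : realType) (K Y : topologicalType) (phi : K -> Y) (y : Y).
Hypotheses (hK : hausdorff_space K) (kK : compact [set: K]).
Hypotheses (hY : hausdorff_space Y) (cphi : continuous phi).
Let A := phi @^-1` [set y].

Lemma fiber_closed : closed A.
Proof.
apply: closed_comp; first by move=> p _; exact: cphi.
exact/accessible_closed_set1/hausdorff_accessible.
Qed.

(** The image of the complement of [W] is compact, hence closed, and misses [y]. *)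
Lemma fiber_nbhd (W : set K) : open W -> A `<=` W ->
  exists V, [/\ open V, V y & phi @^-1` V `<=` W].
Proof.
move=> Wo AW; have : closed (phi @` (~` W)).
  apply: (compact_closed hY); apply: continuous_compact.
    exact: continuous_subspaceT.
  by apply: (subclosed_compact _ kK) => //; rewrite closedC.
move=> cl; exists (~` (phi @` (~` W))); split; first by rewrite openC.
- by move=> [p nWp py]; apply: nWp; exact: AW.
- by move=> p /= np; apply: contrapT => nWp; apply: np; exists p.
Qed.

Lemma fiber_nonempty : (forall V, open V -> V y -> (phi @^-1` V) !=set0) ->
  A !=set0.
Proof.
move=> h; apply: contrapT => /set0P/negP/negPn/eqP A0.
have [||V [Vo Vy V0]] := @fiber_nbhd set0; [exact: open0|by rewrite A0|].
by have [p /V0] := h V Vo Vy.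
Qed.

(** [S] meets [O] in a relatively clopen set, closed because it is also the part of [S] off [O']. *)
Lemma connected_meet (S O O' : set K) : connected S -> open O -> open O' ->
  O `&` O' = set0 -> S `<=` O `|` O' -> S `&` O !=set0 -> S `&` O' = set0.
Proof.
move=> cS oO oO' OO' SOO' SO; apply: contrapT => /eqP/set0P[p [Sp O'p]].
have SE : S `&` O = S.
  apply: cS => //; first by exists O.
  exists (~` O'); first by rewrite closedC.
  apply/seteqP; split=> x [Sx Ox]; split => //.
    by move=> O'x; have : (O `&` O') x by []; rewrite OO'.
  by case: (SOO' _ Sx).
have [_ Op] : (S `&` O) p by rewrite SE.
by have : (O `&` O') p by []; rewrite OO'.
Qed.

Lemma fiber_continuum (p0 : K) : A p0 ->
  (forall p V O O', A p -> open V -> V y -> open O -> O p -> open O' -> O' p0 ->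
    exists S, [/\ connected S, S `<=` phi @^-1` V, S `&` O !=set0 &
      S `&` O' !=set0]) ->
  continuum (set_type A).
Proof.
move=> Ap0 h; split.
- by exists (SigSub (mem_set Ap0)).
- exact/set_type_compact/(subclosed_compact fiber_closed kK).
- have cT := set_type_compact (subclosed_compact fiber_closed kK (@subsetT _ A)).
  move=> B B0 [U Uo]; rewrite setTI => BU [F Fc]; rewrite setTI => BF.
  have Bc : closed B by rewrite BF.
  have cl (D : set (set_type A)) : closed D -> closed ([set \val p | p in D] : set K).
    move=> Dc; apply: (compact_closed hK); apply: continuous_compact.
      exact/continuous_subspaceT/set_val_continuous.
    exact: (subclosed_compact Dc cT).
  have [B1 [B2 [B1o B2o BB1 nBB2 B12]]] : exists U V, [/\ open U, open V,
      [set \val p | p in B] `<=` U, [set \val p | p in ~` B] `<=` V & U `&` V = set0].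
    have /(@normal_openP R) := compact_normal hK kK.
    apply; [exact: cl|by apply: cl; rewrite closedC BU|].
    apply/seteqP; split=> // _ [[p Bp <-] [q nBq /val_inj qp]].
    by apply: nBq; rewrite qp.
  have AB : A `<=` B1 `|` B2.
    move=> p Ap; pose p' : set_type A := SigSub (mem_set Ap).
    by have [Bp|nBp] := pselect (B p'); [left; apply: BB1|right; apply: nBB2]; exists p'.
  have [V [Vo Vy VB]] := fiber_nbhd (openU B1o B2o) AB.
  apply/seteqP; split=> // q _; apply: contrapT => nBq.
  case: B0 => b Bb.
  pose p0' : set_type A := SigSub (mem_set Ap0).
  (* The base point lies on one side of the splitting; [q] or [b] supplies a point on the other. *)
  have [Bp0|nBp0] := pselect (B p0').
  - have [||S [cS SV S1 S2]] := h (\val q) V B2 B1 (set_mem (valP q)) Vo Vy B2o _ B1o _.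
    + by apply: nBB2; exists q.
    + by apply: BB1; exists p0'.
    have [x [Sx B2x]] := S1.
    have : (S `&` B2) x by []. 
    by rewrite (connected_meet cS B1o B2o B12 (subset_trans SV VB) S2).
  - have [||S [cS SV S1 S2]] := h (\val b) V B1 B2 (set_mem (valP b)) Vo Vy B1o _ B2o _.
    + by apply: BB1; exists b.
    + by apply: nBB2; exists p0'.
    have [x [Sx B2x]] := S2.
    have : (S `&` B2) x by [].
    by rewrite (connected_meet cS B1o B2o B12 (subset_trans SV VB) S1).
- exact: set_type_hausdorff.
Qed.

End Fiber.

(** * Non-chainability of a fibre *)

Section NotChainable.
Variable R : realType.

Lemma cos_odd_pi (z : int) : cos (pi + (pi *+ 2) *~ z) = -1 :> R.
Proof.
case: z => n; first by rewrite -pmulrn (periodicn (@cosD2pi R)) cospi.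
by rewrite NegzE mulrNz -pmulrn -(periodicn (@cosD2pi R) n.+1) subrK cospi.
Qed.

Lemma interval_odd_pi (I : set R) a b : is_interval I -> I a -> I b ->
  a + pi *+ 2 <= b -> exists2 x, I x & cos x = -1.
Proof.
move=> iI Ia Ib ab; pose z := Num.floor ((a - pi) / (pi *+ 2)).
have p0 : 0 < pi *+ 2 :> R by rewrite mulrn_wgt0// pi_gt0.
have /andP[] := floor_itv ((a - pi) / (pi *+ 2)); rewrite -/z.
rewrite ler_pdivlMr// ltr_pdivrMr// => z1 z2.
(* This is the first odd multiple of pi beyond [a], so it is at most [a + pi *+ 2]. *)
exists (pi + (pi *+ 2) *~ (z + 1)); last exact: cos_odd_pi.
apply: (iI a b) => //; rewrite -mulrzr.
move: z1 z2; rewrite intrD; set w := z%:~R; rewrite mulr2n in ab p0 *.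
by move=> z1 z2; apply/andP; split; lra.
Qed.

Lemma dense_eq (T : topologicalType) (U : topologicalType) (D : set T)
    (f g : T -> U) : hausdorff_space U -> closure D = setT ->
  continuous f -> continuous g -> {in D, f =1 g} -> f =1 g.
Proof.
move=> hU dD cf cg fg p; apply: hU => V W Vp Wp.
have : closure D p by rewrite dD.
move=> /(_ _ (filterI (cf p V Vp : nbhs p (f @^-1` V)) (cg p W Wp)))[q [Dq [/= Vq Wq]]].
by exists (f q); split=> //; rewrite fg ?inE.
Qed.

(** The last hypothesis supplies, over every neighbourhood of [y], connected pieces of [X] on which
    [t] varies as much as desired. *)
Lemma fiber_not_chainable (K Y X : topologicalType) (phi : K -> Y) (y : Y)
    (i : X -> K) (t : X -> R) (c s : K -> R) :
  hausdorff_space K -> compact [set: K] -> hausdorff_space Y ->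
  continuous phi -> continuous i -> closure (range i) = setT ->
  continuous t -> continuous c -> continuous s ->
  (forall x, c (i x) = cos (t x)) -> (forall x, s (i x) = sin (t x)) ->
  (forall V B, open V -> V y -> exists S a b, [/\ connected S,
    forall x, S x -> V (phi (i x)), S a, S b & t a + B <= t b]) ->
  ~ chainable (set_type (phi @^-1` [set y])).
Proof.
move=> hK kK hY cphi ci di ct cc cs cE sE h chA.
have e p : c p ^+ 2 + s p ^+ 2 = 1.
  apply: (@dense_eq K R (range i) (fun p => c p ^+ 2 + s p ^+ 2) (cst 1)) => //.
  - by move=> q; apply: cvgD; apply: cvgM; [exact: cc|exact: cc|exact: cs|exact: cs].
  - exact: cst_continuous.
  - by move=> _ /set_mem[x _ <-]; rewrite cE sE cos2Dsin2.
have [G [M [cG GM GE]]] := chainable_circle_lift_extension hK kK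
  (fiber_closed hY cphi) chA cc cs (fun p _ => e p).
(* By the addition formula [w] is the cosine of [t - G] on [X], and it is 1 on the fibre. *)
pose w p := c p * cos (G p) + s p * sin (G p).
have cw : continuous w.
  move=> p; apply: cvgD; apply: cvgM.
  - exact: cc.
  - by apply: (continuous_comp (cG p)); exact: continuous_cos.
  - exact: cs.
  - by apply: (continuous_comp (cG p)); exact: continuous_sin.
have [||V [Vo Vy VW]] := fiber_nbhd kK hY cphi (W := w @^-1` [set r | -1 < r]) (y := y).
- by apply: open_comp; [move=> p _; exact: cw|exact: open_gt].
- by move=> p /GE[cG' sG']; rewrite /= /w -cG' -sG' -!expr2 e; lra.
(* [G] changes by at most [M *+ 2] from [a] to [b], which leaves a growth of [pi *+ 2] for
   [t - G]. *)
have [S [a [b [cS SV Sa Sb ab]]]] := h V (M *+ 2 + pi *+ 2) Vo Vy.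
pose D x := t x - G (i x).
have cD : continuous D.
  by move=> x; apply: cvgB; [exact: ct|apply: (continuous_comp (ci x)); exact: cG].
have iD : is_interval (D @` S).
  apply/connected_intervalP/connected_continuous_connected => //.
  exact: continuous_subspaceT.
have [|x] := interval_odd_pi iD (imageP D Sa) (imageP D Sb).
  have := GM (i a); have := GM (i b); rewrite !ler_norml /D.
  by rewrite mulr2n in ab; lra.
move=> [x' Sx' <-]; rewrite /D cosB -cE -sE => wx.
by have /= := VW _ (SV _ Sx'); rewrite /w wx ltxx.
Qed.

End NotChainable.

(** * Extending bounded functions to the Čech-Stone compactification *)

Section StoneCechFacts.
Variable R : realType.

Lemma set_type_lift_continuous (X Y : topologicalType) (A : set Y) (f : X -> Y)
    (fA : forall x, f x \in A) :
  continuous f -> continuous (fun x => SigSub (fA x) : set_type A).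
Proof. by move=> cf; exact: (@continuous_comp_initial (set_type A) X Y \val). Qed.

(** A map into [[0, 1]] is itself an index of the cube; its extension is the projection to that
    coordinate. *)
Lemma stone_cech_extension01 (X : topologicalType) (f : X -> R) : continuous f ->
  (forall x, 0 <= f x <= 1) ->
  exists2 F : stone_cech R X -> R, continuous F & forall x, F (sc_unit R x) = f x.
Proof.
move=> cf f01.
have fI x : f x \in (`[0, 1]%classic : set R) by rewrite inE/= in_itv/= f01.
pose g x : unit_itv R := SigSub (fI x).
have gc : continuous g by exact: set_type_lift_continuous.
exists (fun p => \val ((\val p : sc_cube R X) (mkcts gc))) => // p.
apply: (@continuous_comp (stone_cech R X) (unit_itv R) R
  (fun p => (set_val p : sc_cube R X) (mkcts gc)) set_val p);
  last exact: set_val_continuous.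
apply: (@continuous_comp (stone_cech R X) (sc_cube R X) (unit_itv R)
  set_val (fun q => q (mkcts gc)) p); first exact: set_val_continuous.
exact: sc_proj_continuous.
Qed.

Lemma affine_continuous (X : topologicalType) (f : X -> R) (a b : R) :
  continuous f -> continuous (fun x => f x * a + b).
Proof.
by move=> cf x; apply: cvgD; [apply: cvgM; [exact: cf|]|]; exact: cvg_cst.
Qed.

Lemma stone_cech_extension_sym (X : topologicalType) (f : X -> R) : continuous f ->
  (forall x, -1 <= f x <= 1) ->
  exists2 F : stone_cech R X -> R, continuous F & forall x, F (sc_unit R x) = f x.
Proof.
move=> cf f1.
have [||F cF FE] := @stone_cech_extension01 X (fun x => f x / 2 + 2^-1).
- exact: affine_continuous.
- by move=> x; have := f1 x; lra.
exists (fun p => F p * 2 - 1) => [|x]; last by rewrite FE; lra.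
exact: affine_continuous.
Qed.

Lemma sc_fiber_not_chainable (X Y : topologicalType) (phi : stone_cech R X -> Y)
    (y : Y) (t : X -> R) :
  hausdorff_space Y -> continuous phi -> continuous t ->
  (forall V B, open V -> V y -> exists S a b, [/\ connected S,
    forall x, S x -> V (phi (sc_unit R x)), S a, S b & t a + B <= t b]) ->
  ~ chainable (set_type (phi @^-1` [set y])).
Proof.
move=> hY cphi ct h.
have [||c cc cE] := @stone_cech_extension_sym X (fun x => cos (t x)).
- by move=> x; apply: (continuous_comp (ct x)); exact: continuous_cos.
- by move=> x; rewrite cos_geN1 cos_le1.
have [||s cs sE] := @stone_cech_extension_sym X (fun x => sin (t x)).
- by move=> x; apply: (continuous_comp (ct x)); exact: continuous_sin.
- by move=> x; rewrite sin_geN1 sin_le1.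
apply: (fiber_not_chainable (@stone_cech_hausdorff R X) (@stone_cech_compact R X)
  hY cphi (@sc_unit_continuous R X) (@sc_unit_dense R X) ct cc cs cE sE h).
Qed.

Lemma sc_dense (X : topologicalType) (O : set (stone_cech R X)) p :
  open O -> O p -> exists x, O (sc_unit R x).
Proof.
move=> oO Op; have : closure (range (@sc_unit R X)) p by rewrite sc_unit_dense.
by move=> /(_ O (open_nbhs_nbhs (conj oO Op)))[_ [[x _ <-] Ox]]; exists x.
Qed.

Lemma sc_unit_connected (X : topologicalType) (S : set X) :
  connected S -> connected (@sc_unit R X @` S).
Proof.
move=> cS; apply: connected_continuous_connected => //.
exact/continuous_subspaceT/sc_unit_continuous.
Qed.

End StoneCechFacts.

(** * The remainder of the half line *)

Section HalfLine.
Variable R : realType.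
Local Notation HH := (HH R).

Lemma HH_ge0 (x : HH) : 0 <= \val x.
Proof. by have /set_mem/= := valP x; rewrite in_itv/= andbT. Qed.

Lemma HH_projP (r : R) : `|r| \in (`[0, +oo[%classic : set R).
Proof. by rewrite inE/= in_itv/= andbT. Qed.

(** The absolute value serves as a retraction onto the half line, so every real names a point of
    it. *)
Definition HH_proj (r : R) : HH := SigSub (HH_projP r).

Lemma HH_proj_continuous : continuous HH_proj.
Proof.
exact/set_type_lift_continuous/norm_continuous.
Qed.

Lemma HH_projE r : 0 <= r -> \val (HH_proj r) = r.
Proof. by move=> r0 /=; rewrite ger0_norm. Qed.

Lemma HH_valK (x : HH) : HH_proj (\val x) = x.
Proof. by apply: val_inj; rewrite HH_projE// HH_ge0. Qed.

Definition decay (x : HH) : R := (1 + \val x)^-1.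

Lemma decay_gt0 x : 0 < decay x.
Proof. by rewrite invr_gt0 ltr_wpDr// HH_ge0. Qed.

Lemma decay_lt e x : (decay x < e) = (1 < e * (1 + \val x)).
Proof.
by rewrite /decay -[X in X < _]mul1r ltr_pdivrMr// ltr_wpDr// HH_ge0.
Qed.

Lemma decay_continuous : continuous decay.
Proof.
move=> x; apply: (@continuous_comp HH R R \val (fun r => (1 + r)^-1)).
  exact: set_val_continuous.
apply: cvgV; first by rewrite gt_eqF// ltr_wpDr// HH_ge0.
by apply: cvgD; [exact: cvg_cst|exact: cvg_id].
Qed.

Lemma decay_tail_connected e : connected [set x | decay x < e].
Proof.
have -> : [set x | decay x < e] = HH_proj @` [set r | 0 <= r /\ 1 < e * (1 + r)].
  apply/seteqP; split=> [x /=|_ [r [r0 re] <-] /=]; last by rewrite decay_lt HH_projE.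
  rewrite decay_lt => xe; exists (\val x); rewrite ?HH_valK//.
  by split=> //; exact: HH_ge0.
apply: connected_continuous_connected.
  apply/connected_intervalP => a b [a0 ae] [b0 be] c /andP[ac cb] /=.
  split; first exact: le_trans ac.
  (* The sign of [e] is read off from [1 < e * (1 + a)]. *)
  have e0 : 0 <= e by rewrite -(@pmulr_lge0 _ (1 + a)) ?ltr_wpDr//; lra.
  by apply: (lt_le_trans ae); rewrite ler_wpM2l// lerD2l.
exact/continuous_subspaceT/HH_proj_continuous.
Qed.

Lemma HH_compact_decay e : 0 < e -> compact [set x | e <= decay x].
Proof.
move=> e0.
apply: (@subclosed_compact HH _ (HH_proj @` `[0, e^-1]%classic)).
- apply: (@closed_comp HH R decay [set r | e <= r]); last exact: closed_ge.
  by move=> x _; exact: decay_continuous.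
- apply: continuous_compact; last exact: segment_compact.
  exact/continuous_subspaceT/HH_proj_continuous.
- move=> x /= ex; exists (\val x); last exact: HH_valK.
  rewrite /= in_itv/= HH_ge0/=.
  move: ex; rewrite leNgt decay_lt -leNgt => ex.
  rewrite -(ler_pM2l e0) mulfV ?gt_eqF//; apply: le_trans ex.
  by rewrite ler_pM2l// lerDr ler01.
Qed.

(** The extension of [decay] is positive on the half line itself. At a point of the remainder a
    positive value is impossible, since [decay] is bounded below only on compact sets. *)
Lemma HH_star_fiber : exists2 phi : stone_cech R HH -> R, continuous phi &
  (forall x, phi (sc_unit R x) = decay x) /\ HH_star R = phi @^-1` [set 0].
Proof.
have [||phi cphi phiE] := @stone_cech_extension01 R HH decay.
- exact: decay_continuous.
- move=> x; rewrite ltW ?decay_gt0//= invf_le1 ?lerDl ?HH_ge0//.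
  by rewrite ltr_wpDr// HH_ge0.
exists phi => //; split=> //; apply/seteqP; split=> p /=; last first.
  by move=> p0 [x _ xp]; move: p0; rewrite -xp phiE => /eqP; rewrite gt_eqF// decay_gt0.
move=> np; have ge0 : 0 <= phi p.
  rewrite leNgt; apply/negP => p0.
  have [|x] := @sc_dense R HH (phi @^-1` [set r | r < 0]) p _ p0.
    by apply: open_comp; [move=> q _; exact: cphi|exact: open_lt].
  by rewrite /= phiE ltNge ltW// decay_gt0.
apply/eqP; rewrite eq_le ge0 andbT leNgt; apply/negP => p0.
(* Half the value at [p] leaves room: [D] is compact and misses [p], yet points of the half line
   close to [p] would lie in it. *)
pose D := @sc_unit R HH @` [set x | phi p / 2 <= decay x].
have Dc : closed D.
  apply: (compact_closed (@stone_cech_hausdorff R HH)).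
  apply: continuous_compact; first exact/continuous_subspaceT/sc_unit_continuous.
  by apply: HH_compact_decay; lra.
have [||x] := @sc_dense R HH (~` D `&` phi @^-1` [set r | phi p / 2 < r]) p.
- apply: openI; first by rewrite openC.
  by apply: open_comp; [move=> q _; exact: cphi|exact: open_gt].
- by split=> /=; [move=> [x _ xp]; apply: np; exists x|lra].
by move=> [nD /=]; rewrite phiE => h; apply: nD; exists x => //=; exact: ltW.
Qed.

Lemma HH_star_continuum_not_chainable :
  continuum (set_type (HH_star R)) /\ ~ chainable (set_type (HH_star R)).
Proof.
have [phi cphi [phiE ->]] := HH_star_fiber.
have hK := @stone_cech_hausdorff R HH; have kK := @stone_cech_compact R HH.
have hR : hausdorff_space R := @Rhausdorff R.
have ball0 (V : set R) : open V -> V 0 -> exists2 e, 0 < e &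
    forall r, 0 < r -> r < e -> V r.
  move=> Vo V0; have /nbhs_ballP[e /= e0 eV] := open_nbhs_nbhs (conj Vo V0).
  exists e => // r r0 re; apply: eV.
  by rewrite /ball/= sub0r normrN gtr0_norm.
(* Here [e * (1 + (e^-1 + r))] is [1 + e + e * r], which exceeds 1. *)
have far e r : 0 < e -> 0 <= r -> decay (HH_proj (e^-1 + r)) < e.
  move=> e0 r0; rewrite decay_lt HH_projE ?addr_ge0// ?invr_ge0 ?ltW//.
  have := mulfV (lt0r_neq0 e0); set i := e^-1 => ei.
  have : 0 <= e * r by rewrite mulr_ge0// ltW.
  by rewrite !mulrDr; lra.
split.
- have [|p0 p0A] := fiber_nonempty (phi := phi) (y := 0) kK hR cphi.
    move=> V Vo V0; have [e e0 eV] := ball0 V Vo V0.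
    exists (sc_unit R (HH_proj (e^-1 + 0))) => /=; rewrite phiE.
    by apply: eV; [exact: decay_gt0|exact: far].
  apply: (fiber_continuum R hK kK hR cphi p0A) => p V O O' pA Vo V0 oO Op oO' Op0.
  have [e e0 eV] := ball0 V Vo V0.
  (* By density, any open set around a point of the fibre meets every tail. *)
  have meet Q q : open Q -> Q q -> phi q = 0 ->
      (@sc_unit R HH @` [set x | decay x < e]) `&` Q !=set0.
    move=> oQ Qq q0; have [||x] := @sc_dense R HH (Q `&` phi @^-1` [set r | r < e]) q.
    - apply: openI => //.
      by apply: open_comp; [move=> z _; exact: cphi|exact: open_lt].
    - by split=> //=; rewrite q0.
    by move=> [Qx /=]; rewrite phiE => xe; exists (sc_unit R x); split=> //; exists x.
  exists (@sc_unit R HH @` [set x | decay x < e]); split.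
  + exact/sc_unit_connected/decay_tail_connected.
  + by move=> _ [x /= xe <-]; rewrite /= phiE; apply: eV => //; exact: decay_gt0.
  + exact: (meet O p).
  + exact: (meet O' p0).
- apply: (@sc_fiber_not_chainable R HH R phi 0 (fun x => \val x) hR cphi).
    exact: set_val_continuous.
  move=> V B Vo V0; have [e e0 eV] := ball0 V Vo V0.
  (* Taking [|B|] keeps the second point on the half line when [B] is negative. *)
  exists [set x | decay x < e], (HH_proj (e^-1 + 0)), (HH_proj (e^-1 + `|B|)); split.
  + exact: decay_tail_connected.
  + by move=> x xe; rewrite phiE; apply: eV => //; exact: decay_gt0.
  + exact: far.
  + exact: far.
  + have ei : 0 <= e^-1 by rewrite invr_ge0 ltW.
    rewrite (HH_projE (addr_ge0 ei (lexx 0))) (HH_projE (addr_ge0 ei (normr_ge0 B))).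
    by rewrite addr0 lerD2l ler_norm.
Qed.

End HalfLine.

(** * The continua [II u] *)

Section StandardSubcontinua.
Variable R : realType.
Local Notation MM := (MM R).
Local Notation II01 := (`[0, 1]%classic : set R).

Lemma set_type_connected (X : topologicalType) (A : set X) :
  connected A -> connected [set: set_type A].
Proof.
move=> cA; have [->|/set0P[a Aa]] := eqVneq A set0.
  suff -> : [set: set_type (set0 : set X)] = set0 by exact: connected0.
  by apply/seteqP; split=> // x _; have /set_mem := valP x.
(* An inverse of [\val] on [A], made total by the point [a]; it carries connectedness from [A] to
   the subtype. *)
pose lift x : set_type A :=
  if pselect (A x) is left Ax then SigSub (mem_set Ax) else SigSub (mem_set Aa).
have liftE : sigL A lift = id.
  apply/funext => x; rewrite /sigL /= /lift.
  case: pselect => [Ax|/(_ (set_mem (valP x)))//]; exact: val_inj.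
have -> : [set: set_type A] = lift @` A.
  apply/seteqP; split=> // x _; exists (\val x); first exact: set_mem (valP x).
  by rewrite -[RHS](congr1 (@^~ x) liftE).
apply: connected_continuous_connected => //.
by apply/subspace_sigL_continuousP; rewrite liftE => x; exact: cvg_id.
Qed.

Lemma nat_continuous (Y : topologicalType) (f : nat -> Y) : continuous f.
Proof. by move=> m V /nbhs_singleton Vm; apply/principal_filterP. Qed.

Lemma pair_continuous (X Y : topologicalType) (x : X) :
  continuous (fun y : Y => (x, y)).
Proof. by move=> y; apply: cvg_pair; [exact: cvg_cst|exact: cvg_id]. Qed.

Lemma mem0_itv : 0 \in II01.
Proof. by rewrite inE/= in_itv/= lexx ler01. Qed.

Lemma mem1_itv : 1 \in II01.
Proof. by rewrite inE/= in_itv/= lexx ler01. Qed.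

Definition itv0 : unit_itv R := SigSub mem0_itv.
Definition itv1 : unit_itv R := SigSub mem1_itv.

Definition base_point (n : nat) : MM := (n, itv0).

Definition slice (n : nat) : set MM := [set x | x.1 = n].

Lemma slice_connected n : connected (slice n).
Proof.
have -> : slice n = (fun r => (n, r) : MM) @` [set: unit_itv R].
  apply/seteqP; split=> [[m r] mn|_ [r _ <-]//]; exists r => //.
  by rewrite -(mn : m = n).
apply: connected_continuous_connected.
  exact/set_type_connected/segment_connected.
exact/continuous_subspaceT/pair_continuous.
Qed.

Definition winding (x : MM) : R := x.1%:R * \val x.2.

Lemma winding_continuous : continuous winding.
Proof.
move=> x; apply: (@cvgM R MM (nbhs x) _ (fun z : MM => z.1%:R) (fun z : MM => \val z.2)).
  apply: (@continuous_comp MM nat R fst (fun n => n%:R)); first exact: fst_continuous.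
  exact: nat_continuous.
apply: (@continuous_comp MM (unit_itv R) R snd \val); first exact: cvg_snd.
exact: set_val_continuous.
Qed.

(** Removing the finitely many points below [N] leaves an open neighbourhood of [u]. *)
Lemma remainder_nat_unbounded (u : stone_cech R nat) (V : set (stone_cech R nat))
    (N : nat) : remainder R nat u -> open V -> V u ->
  exists2 n, (N <= n)%N & V (sc_unit R n).
Proof.
move=> ru Vo Vu.
pose D := @sc_unit R nat @` `I_N.
have Dc : closed D.
  have /hausdorff_accessible/accessible_finite_set_closed := @stone_cech_hausdorff R nat.
  by apply; exact/finite_image/finite_II.
have [||n [nD Vn]] := @sc_dense R nat (~` D `&` V) u.
- by apply: openI => //; rewrite openC.
- by split=> // -[n _ nu]; apply: ru; exists n.
by exists n => //; rewrite leqNgt; apply/negP => nN; apply: nD; exists n.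
Qed.

Lemma II_continuum_not_chainable (u : stone_cech R nat) : remainder R nat u ->
  continuum (set_type (II u)) /\ ~ chainable (set_type (II u)).
Proof.
move=> ru.
have hK := @stone_cech_hausdorff R MM; have kK := @stone_cech_compact R MM.
have hN := @stone_cech_hausdorff R nat.
pose phi : stone_cech R MM -> stone_cech R nat := sc_map (MM_proj R).
have cphi : continuous phi by exact: sc_map_continuous.
have phiE x : phi (sc_unit R x) = sc_unit R x.1 by exact: sc_map_unit.
(* Extending [base_point] gives a section of [phi], so [sg u] is a point of the fibre and can serve
   as its base point. *)
pose sg : stone_cech R nat -> stone_cech R MM :=
  sc_map (mkcts (@nat_continuous MM base_point)).
have csg : continuous sg by exact: sc_map_continuous.
have sgE n : sg (sc_unit R n) = sc_unit R (base_point n) by exact: sc_map_unit.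
have phisg p : phi (sg p) = p.
  apply: (@dense_eq _ _ (range (@sc_unit R nat)) (phi \o sg) id) => //.
  - exact: sc_unit_dense.
  - by move=> q; apply: continuous_comp; [exact: csg|exact: cphi].
  - by move=> q; exact: cvg_id.
  - by move=> _ /set_mem[n _ <-]; rewrite /= sgE phiE.
split.
- apply: (@fiber_continuum R _ _ phi u hK kK hN cphi (sg u) (phisg u)).
  move=> p V O O' pA Vo Vu oO Op oO' Osg.
  (* Pulling [O'] back along [sg] and [phi] forces the base point of the same slice into [O'], so
     slice [n] meets both [O] and [O']. *)
  have [||[n r] [[Ox Vx] O'x]] := @sc_dense R MM
      (O `&` phi @^-1` V `&` phi @^-1` (sg @^-1` O')) p.
  + apply: openI; first apply: openI => //.
      by apply: open_comp => // q _; exact: cphi.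
    apply: open_comp; first by move=> q _; exact: cphi.
    by apply: open_comp => // q _; exact: csg.
  + by rewrite /= pA.
  rewrite /= phiE /= in Vx; rewrite /= phiE sgE in O'x.
  exists (@sc_unit R MM @` slice n); split.
  + exact/sc_unit_connected/slice_connected.
  + by move=> _ [x xn <-]; rewrite /= phiE xn.
  + by exists (sc_unit R ((n, r) : MM)); split=> //; exists (n, r).
  + by exists (sc_unit R (base_point n)); split=> //; exists (base_point n).
- apply: (@sc_fiber_not_chainable R MM _ phi u winding hN cphi winding_continuous).
  move=> V B Vo Vu.
  (* On slice [n] the function [winding] runs from 0 to [n], so [n] is taken above [|B|]. *)
  have [n Bn Vn] := remainder_nat_unbounded (Num.bound `|B|) ru Vo Vu.
  exists (slice n), (base_point n), ((n, itv1) : MM); split => //.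
  + exact: slice_connected.
  + by move=> x xn; rewrite phiE xn.
  + rewrite /winding /= mulr0 add0r mulr1 (le_trans (ler_norm B))//.
    by rewrite (le_trans (ltW (archi_boundP (normr_ge0 B))))// ler_nat.
Qed.

End StandardSubcontinua.

Theorem mainTheorem3 (R : realType) :
  (continuum (set_type (HH_star R)) /\ ~ chainable (set_type (HH_star R))) /\
  (forall u : stone_cech R nat, remainder R nat u ->
     continuum (set_type (II u)) /\ ~ chainable (set_type (II u))).
Proof.
split; first exact: HH_star_continuum_not_chainable.
by move=> u; exact: II_continuum_not_chainable.
Qed.
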